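(* Let $\mathscr{D}=\langle \mathscr{B},\mathscr{C}\rangle$ be a semiorthogonal decomposition of a triangulated category, and let $\tau=(\mathscr{D}^{\le 0},\mathscr{D}^{\ge 0})$ be a t-structure on $\mathscr{D}$. (a) If $\tau$ is noetherian and restricts to a t-structure on $\mathscr{B}$, then $\tau$ connectively induces a t-structure $\tau_{\mathscr{C}}^{-}$ on $\mathscr{C}$, which is bounded if $\tau$ is bounded. (b) If $\tau$ is artinian and restricts to a t-structure on $\mathscr{C}$, then $\tau$ coconnectively induces a t-structure $\tau_{\mathscr{B}}^{+}$ on $\mathscr{B}$, which is bounded if $\tau$ is bounded.
   Context: Convention: in a semiorthogonal decomposition $\mathscr{D}=\langle \mathscr{B},\mathscr{C}\rangle$ one has $\mathrm{Hom}(C,B[n])=0$ for all $C\in\mathscr{C}$, $B\in\mathscr{B}$, $n\in\mathbf{Z}$, and every $D\in\mathscr{D}$ fits in a distinguished triangle $C\to D\to B$ with $C\in\mathscr{C}$, $B\in\mathscr{B}$. For a t-structure $\tau=(\mathscr{D}^{\le 0},\mathscr{D}^{\ge 0})$ put $\mathscr{D}^{\le n}=\mathscr{D}^{\le 0}[-n]$, $\mathscr{D}^{\ge n}=\mathscr{D}^{\ge 0}[-n]$; its heart is $\mathscr{D}^{\heartsuit}=\mathscr{D}^{\le 0}\cap\mathscr{D}^{\ge 0}$. The t-structure is noetherian (resp. artinian) if its heart is a noetherian (resp. artinian) abelian category, i.e. ascending (resp. descending) chains of subobjects of any object stabilize. It is bounded if every object lies in $\mathscr{D}^{\ge a}\cap\mathscr{D}^{\le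 b}$ for some $a,b\in\mathbf{Z}$. Let $\mathscr{A}\subset\mathscr{D}$ be a full triangulated subcategory. - $\tau$ restricts to a t-structure on $\mathscr{A}$ if $(\mathscr{D}^{\le 0}\cap\mathscr{A},\ \mathscr{D}^{\ge 0}\cap\mathscr{A})$ is a t-structure on $\mathscr{A}$. - $\tau$ connectively induces a t-structure on $\mathscr{A}$ if the pair $\tau_{\mathscr{A}}^{-}=(\mathscr{A}^{\le 0},\mathscr{A}^{\ge 0})$ with $\mathscr{A}^{\le 0}=\mathscr{D}^{\le 0}\cap\mathscr{A}$ and $\mathscr{A}^{\ge 0}=\{A\in\mathscr{A} : \mathrm{Hom}(A'[1],A)=0 \text{ for all } A'\in\mathscr{A}^{\le 0}\}$ is a t-structure on $\mathscr{A}$. - $\tau$ coconnectively induces a t-structure on $\mathscr{A}$ if the pair $\tau_{\mathscr{A}}^{+}=(\mathscr{A}^{\le 0},\mathscr{A}^{\ge 0})$ with $\mathscr{A}^{\ge 0}=\mathscr{D}^{\ge 0}\cap\mathscr{A}$ and $\mathscr{A}^{\le 0}=\{A\in\mathscr{A} : \mathrm{Hom}(A,A'[-1])=0 \text{ for all } A'\in\mathscr{A}^{\ge 0}\}$ is a t-structure on $\mathscr{A}$. *)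

(* Defs.v *)
From mathcomp Require Import all_boot all_order all_algebra.
From mathcomp Require Import boolp classical_sets.

Set Implicit Arguments.
Unset Strict Implicit.
Unset Printing Implicit Defensive.

Import GRing.Theory.
Local Open Scope classical_set_scope.
Local Open Scope ring_scope.

(* The decidable equality and choice operator that [zmodType] bundles with an
   abelian group are no restriction: classically every type has them. *)
Record preadditive := Preadditive {
  Ob :> Type;
  Hom : Ob -> Ob -> zmodType;
  idm : forall X, Hom X X;
  compose : forall X Y Z, Hom Y Z -> Hom X Y -> Hom X Z;
  comp1m : forall X Y (f : Hom X Y), compose (idm Y) f = f;
  compm1 : forall X Y (f : Hom X Y), compose f (idm X) = f;
  compA : forall X Y Z W (h : Hom Z W) (g : Hom Y Z) (f : Hom X Y),
    compose h (compose g f) = compose (compose h g) f;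
  compDl : forall X Y Z (g g' : Hom Y Z) (f : Hom X Y),
    compose (g + g') f = compose g f + compose g' f;
  compDr : forall X Y Z (g : Hom Y Z) (f f' : Hom X Y),
    compose g (f + f') = compose g f + compose g f'
}.

Arguments Hom {_} _ _.
Arguments idm {_} _.
Arguments compose {_ _ _ _} _ _.

Declare Scope cat_scope.
Notation "g ∘ f" := (compose g f) (at level 40, left associativity) : cat_scope.
Local Open Scope cat_scope.

Definition is_iso (D : preadditive) (X Y : D) (f : Hom X Y) : Prop :=
  exists g : Hom Y X, g ∘ f = idm X /\ f ∘ g = idm Y.

Definition isomorphic (D : preadditive) (X Y : D) : Prop :=
  exists f : Hom X Y, is_iso f.

Definition hom_zero (D : preadditive) (X Y : D) : Prop :=
  forall f : Hom X Y, f = 0.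

Definition is_zero (D : preadditive) (Z : D) : Prop :=
  forall X : D, hom_zero X Z /\ hom_zero Z X.

Record is_biproduct (D : preadditive) (X Y S : D)
    (i : Hom X S) (j : Hom Y S) (p : Hom S X) (q : Hom S Y) : Prop := {
  biprod_pi : p ∘ i = idm X;
  biprod_qj : q ∘ j = idm Y;
  biprod_pj : p ∘ j = 0;
  biprod_qi : q ∘ i = 0;
  biprod_sum : i ∘ p + j ∘ q = idm S
}.

Record additive := Additive {
  preadditive_of :> preadditive;
  has_zero : exists Z : preadditive_of, is_zero Z;
  has_biproducts : forall X Y : preadditive_of,
    exists (S : preadditive_of) (i : Hom X S) (j : Hom Y S)
      (p : Hom S X) (q : Hom S Y), is_biproduct i j p q
}.

Record functor (C D : preadditive) := Functor {
  fob :> C -> D;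
  fhom : forall X Y : C, Hom X Y -> Hom (fob X) (fob Y);
  fhom1 : forall X : C, fhom (idm X) = idm (fob X);
  fhomM : forall (X Y Z : C) (g : Hom Y Z) (f : Hom X Y),
    fhom (g ∘ f) = fhom g ∘ fhom f
}.

Arguments fhom {C D} _ {X Y} _.

Definition additive_functor (C D : preadditive) (F : functor C D) : Prop :=
  forall (X Y : C) (f g : Hom X Y), fhom F (f + g) = fhom F f + fhom F g.

(* G \o F is naturally isomorphic to the identity of C *)
Definition left_quasi_inverse (C D : preadditive)
    (F : functor C D) (G : functor D C) : Prop :=
  exists eta : forall X : C, Hom X (G (F X)),
    (forall X, is_iso (eta X)) /\
    (forall (X Y : C) (f : Hom X Y),
       eta Y ∘ f = fhom G (fhom F f) ∘ eta X).

(* The shift [1] is an autoequivalence, with a chosen quasi-inverse [-1];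
   strict invertibility is not required. *)
Record triangulated := Triangulated {
  additive_of :> additive;
  sh : functor additive_of additive_of;
  ush : functor additive_of additive_of;
  sh_additive : additive_functor sh;
  sh_ush : left_quasi_inverse sh ush;
  ush_sh : left_quasi_inverse ush sh;
  (* [dist f g h]: X -f-> Y -g-> Z -h-> X[1] is a distinguished triangle *)
  dist : forall X Y Z : additive_of,
    Hom X Y -> Hom Y Z -> Hom Z (sh X) -> Prop;
  dist_iso : forall (X Y Z X' Y' Z' : additive_of)
      (f : Hom X Y) (g : Hom Y Z) (h : Hom Z (sh X))
      (f' : Hom X' Y') (g' : Hom Y' Z') (h' : Hom Z' (sh X'))
      (a : Hom X X') (b : Hom Y Y') (c : Hom Z Z'),
    is_iso a -> is_iso b -> is_iso c ->
    b ∘ f = f' ∘ a -> c ∘ g = g' ∘ b -> fhom sh a ∘ h = h' ∘ c ->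
    dist f g h -> dist f' g' h';
  dist_id : forall X Z : additive_of, is_zero Z ->
    dist (idm X) (0 : Hom X Z) (0 : Hom Z (sh X));
  dist_cone : forall (X Y : additive_of) (f : Hom X Y),
    exists (Z : additive_of) (g : Hom Y Z) (h : Hom Z (sh X)), dist f g h;
  dist_rot : forall (X Y Z : additive_of)
      (f : Hom X Y) (g : Hom Y Z) (h : Hom Z (sh X)),
    dist f g h <-> dist g h (- fhom sh f);
  dist_fill : forall (X Y Z X' Y' Z' : additive_of)
      (f : Hom X Y) (g : Hom Y Z) (h : Hom Z (sh X))
      (f' : Hom X' Y') (g' : Hom Y' Z') (h' : Hom Z' (sh X'))
      (a : Hom X X') (b : Hom Y Y'),
    dist f g h -> dist f' g' h' -> b ∘ f = f' ∘ a ->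
    exists c : Hom Z Z', c ∘ g = g' ∘ b /\ fhom sh a ∘ h = h' ∘ c;
  dist_octa : forall (X Y Z Z' X' Y' : additive_of)
      (f : Hom X Y) (g : Hom Y Z)
      (a : Hom Y Z') (a' : Hom Z' (sh X))
      (b : Hom Z X') (b' : Hom X' (sh Y))
      (c : Hom Z Y') (c' : Hom Y' (sh X)),
    dist f a a' -> dist g b b' -> dist (g ∘ f) c c' ->
    exists (u : Hom Z' Y') (v : Hom Y' X'),
      [/\ dist u v (fhom sh a ∘ b'),
          u ∘ a = c ∘ g /\ c' ∘ u = a' &
          v ∘ c = b /\ b' ∘ v = fhom sh f ∘ c']
}.

Arguments sh {_}.
Arguments ush {_}.
Arguments dist {_ _ _ _} _ _ _.

Section TStructures.
Variable D : triangulated.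

(* X[n] *)
Definition shift (n : int) (X : D) : D :=
  match n with
  | Posz k => iter k (fun Y : D => sh Y) X
  | Negz k => iter k.+1 (fun Y : D => ush Y) X
  end.

(* Full subcategories are represented by their classes of objects. *)

Definition replete (A : set D) : Prop :=
  forall X Y : D, isomorphic X Y -> A X -> A Y.

(* A[n], taken as a full subcategory closed under isomorphism *)
Definition shift_set (n : int) (A : set D) : set D :=
  [set X | exists2 Y : D, A Y & isomorphic (shift n Y) X].

Record triangulated_sub (A : set D) : Prop := {
  tsub_replete : replete A;
  tsub_zero : forall Z : D, is_zero Z -> A Z;
  tsub_sh : forall X : D, A X -> A (sh X);
  tsub_ush : forall X : D, A X -> A (ush X);
  tsub_cone : forall (X Y Z : D)
      (f : Hom X Y) (g : Hom Y Z) (h : Hom Z (sh X)),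
    dist f g h -> A X -> A Y -> A Z
}.

Record semiorthogonal_decomposition (B C : set D) : Prop := {
  sod_left : triangulated_sub B;
  sod_right : triangulated_sub C;
  sod_orth : forall (X Y : D) (n : int),
    C X -> B Y -> hom_zero X (shift n Y);
  sod_triangle : forall X : D,
    exists (c b : D) (f : Hom c X) (g : Hom X b) (h : Hom b (sh c)),
      [/\ C c, B b & dist f g h]
}.

(* A candidate t-structure: the pair of the nonpositive and the nonnegative
   part. *)
Definition tpair : Type := (set D * set D)%type.

Definition tle (n : int) (t : tpair) : set D := shift_set (- n) t.1.
Definition tge (n : int) (t : tpair) : set D := shift_set (- n) t.2.

(* [t] is a t-structure on the full triangulated subcategory [A], whose
   distinguished triangles are those of D with vertices in A; [A := setT] gives
   the t-structures on D. *)
Record is_tstructure (A : set D) (t : tpair) : Prop := {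
  tstr_le_sub : t.1 `<=` A;
  tstr_ge_sub : t.2 `<=` A;
  tstr_le_replete : replete t.1;
  tstr_ge_replete : replete t.2;
  tstr_le_shift : t.1 `<=` tle 1 t;
  tstr_ge_shift : tge 1 t `<=` t.2;
  tstr_orth : forall X Y : D, t.1 X -> tge 1 t Y -> hom_zero X Y;
  tstr_triangle : forall X : D, A X ->
    exists (L R : D) (f : Hom L X) (g : Hom X R) (h : Hom R (sh L)),
      [/\ t.1 L, tge 1 t R & dist f g h]
}.

Definition bounded (A : set D) (t : tpair) : Prop :=
  forall X : D, A X -> exists a b : int, (tge a t `&` tle b t) X.

Definition heart (t : tpair) : set D := t.1 `&` t.2.

Definition mono_in (H : set D) (X Y : D) (f : Hom X Y) : Prop :=
  forall (T : D) (u v : Hom T X), H T -> f ∘ u = f ∘ v -> u = v.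

Definition sub_le (S T X : D) (s : Hom S X) (t : Hom T X) : Prop :=
  exists u : Hom S T, s = t ∘ u.

Definition sub_eq (S T X : D) (s : Hom S X) (t : Hom T X) : Prop :=
  sub_le s t /\ sub_le t s.

Definition subobjects (H : set D) (X : D) (S : nat -> D)
    (s : forall n, Hom (S n) X) : Prop :=
  forall n, H (S n) /\ mono_in H (s n).

Definition stabilizes (X : D) (S : nat -> D)
    (s : forall n, Hom (S n) X) : Prop :=
  exists N : nat, forall n : nat, (N <= n)%N -> sub_eq (s n) (s N).

Definition noetherian (t : tpair) : Prop :=
  forall (X : D) (S : nat -> D) (s : forall n, Hom (S n) X),
    heart t X -> subobjects (heart t) s ->
    (forall n, sub_le (s n) (s n.+1)) -> stabilizes s.

Definition artinian (t : tpair) : Prop :=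
  forall (X : D) (S : nat -> D) (s : forall n, Hom (S n) X),
    heart t X -> subobjects (heart t) s ->
    (forall n, sub_le (s n.+1) (s n)) -> stabilizes s.

Definition restrict (t : tpair) (A : set D) : tpair :=
  (t.1 `&` A, t.2 `&` A).

Definition conn (t : tpair) (A : set D) : tpair :=
  (t.1 `&` A,
   [set X | A X /\ forall Y : D, (t.1 `&` A) Y -> hom_zero (sh Y) X]).

Definition coconn (t : tpair) (A : set D) : tpair :=
  ([set X | A X /\ forall Y : D, (t.2 `&` A) Y -> hom_zero X (ush Y)],
   t.2 `&` A).

Definition restricts (t : tpair) (A : set D) : Prop :=
  is_tstructure A (restrict t A).

Definition connectively_induces (t : tpair) (A : set D) : Prop :=
  is_tstructure A (conn t A).

Definition coconnectively_induces (t : tpair) (A : set D) : Prop :=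
  is_tstructure A (coconn t A).

End TStructures.

(* Main.v *)
From mathcomp Require Import ssreflect ssrfun ssrbool eqtype ssrnat.
From mathcomp Require Import ssralg ssrint boolp classical_sets.
Require Import Defs.

Set Implicit Arguments.
Unset Strict Implicit.
Unset Printing Implicit Defensive.

Import GRing.Theory.
Local Open Scope classical_set_scope.
Local Open Scope ring_scope.
Local Open Scope cat_scope.

(** Part (a) amounts to a truncation triangle L -> X -> R for every X in C, with L
    in D^{<=0} ∩ C and R in C receiving no nonzero morphism from D^{<=0} ∩ C.
    The object L is found by three successive coreflections.

    First replace X by P = tau^{<=0} X.  The C-part c of P, in the triangle
    c -> P -> b of the semiorthogonal decomposition, receives the same morphisms
    from C as P does, but it need not be nonpositive: b lies in D^{<=0} (b is
    universal among the maps from P to B, and tau truncates inside B), so c is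
    only in D^{<=1}, and the obstruction is H^0(b).  It vanishes as soon as P has
    no nonzero morphism to B ∩ heart.  The objects of D^{<=0} with this property
    form the class [tilted]: it contains D^{<=0} ∩ C, and P belongs to it exactly
    when H^0(P) is in the class of objects of the heart that are left orthogonal
    to B ∩ heart.  That class is closed under quotients and extensions.  In a
    noetherian abelian category it is therefore the torsion part of a torsion
    pair: a maximal subobject in the class exists ([ses_noetherian_max]), and its
    quotient receives no nonzero morphism from the class, because the image of
    such a morphism could be used to enlarge the subobject
    ([heart_torsion_pair]).  Cutting P down to its torsion part gives the middle
    coreflection P' -> P ([tilted_coreflection]), and now the C-part of P' is
    nonpositive ([tilted_C_part_le]).  The octahedral axiom composes the three
    steps ([approx_trans], [conn_tstr]).

    Part (b) is part (a) in the opposite category.  To make this duality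
    immediate, the argument is carried out for a structure [tricat] whose axioms
    are consequences of those of a triangulated category and are exchanged in
    pairs by reversing arrows.  The third morphism of a triangle is forgotten
    and the shift is kept on objects only, since these are what would make the
    opposite triangulated structure laborious to write down.  Likewise a
    t-structure is described by mutual orthogonality ([tstr]), and chains of
    subobjects in the heart by short exact sequences ([ses_noetherian]), so that
    artinian for tau becomes noetherian for the opposite t-structure.

    Boundedness is inherited because the induced pair contains the intersection
    of the original one with the subcategory. *)

(** * Preadditive categories *)

Section Preadditive.
Variable K : preadditive.

Lemma comp0m (X Y Z : K) (f : Hom X Y) : (0 : Hom Y Z) ∘ f = 0.
Proof. by apply: (addrI (0 ∘ f)); rewrite -compDl !addr0. Qed.

Lemma compm0 (X Y Z : K) (g : Hom Y Z) : g ∘ (0 : Hom X Y) = 0.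
Proof. by apply: (addrI (g ∘ 0)); rewrite -compDr !addr0. Qed.

Lemma compNm (X Y Z : K) (g : Hom Y Z) (f : Hom X Y) : (- g) ∘ f = - (g ∘ f).
Proof. by apply: (addrI (g ∘ f)); rewrite -compDl !subrr comp0m. Qed.

Lemma compmN (X Y Z : K) (g : Hom Y Z) (f : Hom X Y) : g ∘ (- f) = - (g ∘ f).
Proof. by apply: (addrI (g ∘ f)); rewrite -compDr !subrr compm0. Qed.

Lemma is_iso_id (X : K) : is_iso (idm X).
Proof. by exists (idm X); rewrite comp1m. Qed.

Lemma isomorphic_refl (X : K) : isomorphic X X.
Proof. by exists (idm X); apply: is_iso_id. Qed.

Lemma isomorphic_sym (X Y : K) : isomorphic X Y -> isomorphic Y X.
Proof. by case=> f [g [gf fg]]; exists g, f. Qed.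

Lemma isomorphic_trans (X Y Z : K) :
  isomorphic X Y -> isomorphic Y Z -> isomorphic X Z.
Proof.
move=> [f [f' [f'f ff']]] [g [g' [g'g gg']]]; exists (g ∘ f), (f' ∘ g').
split; rewrite -compA.
  by rewrite (compA g') g'g comp1m.
by rewrite (compA f) ff' comp1m.
Qed.

Lemma hom_zero_isol (X X' Y : K) :
  isomorphic X X' -> hom_zero X Y -> hom_zero X' Y.
Proof.
by move=> [e [e' [_ ee']]] XY f; rewrite -(compm1 f) -ee' compA (XY (f ∘ e)) comp0m.
Qed.

Lemma hom_zero_isor (X Y Y' : K) :
  isomorphic Y Y' -> hom_zero X Y -> hom_zero X Y'.
Proof.
by move=> [e [e' [_ ee']]] XY f; rewrite -(comp1m f) -ee' -compA (XY (e' ∘ f)) compm0.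
Qed.

Definition op_cat : preadditive :=
  @Preadditive K (fun X Y => Hom Y X) (@idm K) (fun X Y Z g f => f ∘ g)
    (fun X Y f => compm1 f) (fun X Y f => comp1m f)
    (fun X Y Z W h g f => esym (compA f g h))
    (fun X Y Z g g' f => compDr f g g') (fun X Y Z g f f' => compDl f f' g).

End Preadditive.

(** * A self-dual fragment of the axioms of a triangulated category *)

(** [tri f g] stands for the existence of some h making (f, g, h) distinguished.
    Each axiom is self-dual or is listed together with its dual. *)
Record tricat := Tricat {
  tcat :> preadditive;
  tsh : tcat -> tcat;
  tush : tcat -> tcat;
  tri : forall X Y Z : tcat, Hom X Y -> Hom Y Z -> Prop;
  tsh_tush : forall X, isomorphic (tsh (tush X)) X;
  tush_tsh : forall X, isomorphic (tush (tsh X)) X;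
  hom_zero_adj : forall X Y, hom_zero (tsh X) Y <-> hom_zero X (tush Y);
  tri_isol : forall X X' Y Z (i : Hom X' X) (f : Hom X Y) (g : Hom Y Z),
    is_iso i -> tri f g -> tri (f ∘ i) g;
  tri_isom : forall X Y Y' Z (i : Hom Y Y') (j : Hom Y' Y)
      (f : Hom X Y) (g : Hom Y Z),
    j ∘ i = idm Y -> i ∘ j = idm Y' -> tri f g -> tri (i ∘ f) (g ∘ j);
  tri_isor : forall X Y Z Z' (i : Hom Z Z') (f : Hom X Y) (g : Hom Y Z),
    is_iso i -> tri f g -> tri f (i ∘ g);
  tri_idl : forall X, exists Z (g : Hom X Z), is_zero Z /\ tri (idm X) g;
  tri_idr : forall X, exists Z (f : Hom Z X), is_zero Z /\ tri f (idm X);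
  tri_cone : forall X Y (f : Hom X Y), exists Z (g : Hom Y Z), tri f g;
  tri_fib : forall X Y (g : Hom X Y), exists Z (f : Hom Z X), tri f g;
  tri_rot : forall X Y Z (f : Hom X Y) (g : Hom Y Z), tri f g ->
    exists h : Hom Z (tsh X), tri g h;
  tri_unrot : forall X Y Z (f : Hom X Y) (g : Hom Y Z), tri f g ->
    exists h : Hom (tush Z) X, tri h f;
  tri_exactP : forall X Y Z W (f : Hom X Y) (g : Hom Y Z) (u : Hom W Y),
    tri f g -> g ∘ u = 0 <-> exists v, u = f ∘ v;
  tri_coexactP : forall X Y Z W (f : Hom X Y) (g : Hom Y Z) (u : Hom Y W),
    tri f g -> u ∘ f = 0 <-> exists v, u = v ∘ g;
  tri_octa_cone : forall X Y Z F G E (f : Hom X Y) (g : Hom Y Z)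
      (a : Hom Y F) (b : Hom Z G) (c : Hom Z E),
    tri f a -> tri g b -> tri (g ∘ f) c ->
    exists (u : Hom F E) (v : Hom E G),
      [/\ tri u v, u ∘ a = c ∘ g & v ∘ c = b];
  tri_octa_fib : forall X Y Z F G E (f : Hom X Y) (g : Hom Y Z)
      (a : Hom F X) (b : Hom G Y) (c : Hom E X),
    tri a f -> tri b g -> tri c (g ∘ f) ->
    exists (u : Hom F E) (v : Hom E G),
      [/\ tri u v, c ∘ u = a & b ∘ v = f ∘ c]
}.

Arguments tsh {_}.
Arguments tush {_}.
Arguments tri {_ _ _ _}.

Lemma op_isomorphic (K : preadditive) (X Y : K) :
  isomorphic X Y -> @isomorphic (op_cat K) X Y.
Proof. by case=> f [g [gf fg]]; exists g, f. Qed.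

Lemma op_is_iso (K : preadditive) (X Y : K) (f : Hom X Y) :
  @is_iso (op_cat K) Y X f -> is_iso f.
Proof. by case=> g [gf fg]; exists g. Qed.

Lemma op_is_zero (K : preadditive) (Z : K) :
  is_zero Z -> @is_zero (op_cat K) Z.
Proof. by move=> Z0 X; split=> f; case: (Z0 X) => XZ ZX; [exact: ZX | exact: XZ]. Qed.

(** Reversing the arrows swaps the two shifts and the two ends of a triangle. *)
Definition op_tricat (K : tricat) : tricat.
Proof.
apply: (@Tricat (op_cat K) (@tush K) (@tsh K) (fun X Y Z f g => @tri K _ _ _ g f)).
- by move=> X; apply/op_isomorphic/tush_tsh.
- by move=> X; apply/op_isomorphic/tsh_tush.
- by move=> X Y; split=> /hom_zero_adj.
- by move=> X X' Y Z i f g /op_is_iso; apply: tri_isor.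
- by move=> X Y Y' Z i j f g ji ij; apply: tri_isom.
- by move=> X Y Z Z' i f g /op_is_iso; apply: tri_isol.
- by move=> X; have [Z [f [/op_is_zero Z0 tf]]] := tri_idr X; exists Z, f.
- by move=> X; have [Z [f [/op_is_zero Z0 tf]]] := tri_idl X; exists Z, f.
- by move=> X Y f; have [Z [g tg]] := tri_fib (f : @Hom K Y X); exists Z, g.
- by move=> X Y f; have [Z [g tg]] := tri_cone (f : @Hom K Y X); exists Z, g.
- by move=> X Y Z f g /tri_unrot [h th]; exists h.
- by move=> X Y Z f g /tri_rot [h th]; exists h.
- by move=> X Y Z W f g u tfg; apply: tri_coexactP tfg.
- by move=> X Y Z W f g u tfg; apply: tri_exactP tfg.
- move=> X Y Z F G E f g a b c tf tg tgf.
  by have [u [v [tuv cu bv]]] := tri_octa_fib tg tf tgf; exists v, u.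
- move=> X Y Z F G E f g a b c tf tg tgf.
  by have [u [v [tuv cu bv]]] := tri_octa_cone tg tf tgf; exists v, u.
Defined.

(** * Vanishing of morphisms along triangles *)

Section Triangles.
Variable K : tricat.

Lemma tri_comp0 (X Y Z : K) (f : Hom X Y) (g : Hom Y Z) : tri f g -> g ∘ f = 0.
Proof. by move=> t; apply/(tri_exactP _ t); exists (idm X); rewrite compm1. Qed.

Lemma hom_zero_sh (X Y : K) : hom_zero (tsh X) (tsh Y) <-> hom_zero X Y.
Proof.
split=> [/hom_zero_adj|XY]; first exact/hom_zero_isor/tush_tsh.
exact/hom_zero_adj/(hom_zero_isor (isomorphic_sym (tush_tsh Y))).
Qed.

Lemma hom_zero_tri_mid (X Y Z W : K) (f : Hom X Y) (g : Hom Y Z) :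
  tri f g -> hom_zero W X -> hom_zero W Z -> hom_zero W Y.
Proof.
move=> t WX WZ u; have [v ->] := (tri_exactP u t).1 (WZ _).
by rewrite (WX v) compm0.
Qed.

Lemma hom_zero_tri_r (X Y Z W : K) (f : Hom X Y) (g : Hom Y Z) :
  tri f g -> hom_zero W Y -> hom_zero W (tsh X) -> hom_zero W Z.
Proof. by move=> /tri_rot [h]; apply: hom_zero_tri_mid. Qed.

Lemma tri_sh (X Y Z : K) (f : Hom X Y) (g : Hom Y Z) : tri f g ->
  exists (f' : Hom (tsh X) (tsh Y)) (g' : Hom (tsh Y) (tsh Z)), tri f' g'.
Proof.
by move=> /tri_rot [h /tri_rot [f' /tri_rot [g' t]]]; exists f', g'.
Qed.

(** Successive approximations X <- A <- A' of X by objects A, A' whose cones are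
    right orthogonal to T compose: by the octahedral axiom the cone of the
    composite is an extension of the two cones. *)
Lemma approx_trans (T : set K) (X A A' R R' : K)
    (f : Hom A X) (g : Hom X R) (f' : Hom A' A) (g' : Hom A R') :
  tri f g -> tri f' g' ->
  (forall E, T E -> hom_zero E R) -> (forall E, T E -> hom_zero E R') ->
  exists (R'' : K) (g'' : Hom X R''),
    tri (f ∘ f') g'' /\ forall E, T E -> hom_zero E R''.
Proof.
move=> t t' TR TR'; have [R'' [g'' t'']] := tri_cone (f ∘ f').
have [u [v [tuv _ _]]] := tri_octa_cone t' t t''.
exists R'', g''; split=> // E TE.
exact: hom_zero_tri_mid tuv (TR' _ TE) (TR _ TE).
Qed.

End Triangles.

Lemma hom_zero_ush (K : tricat) (X Y : K) :
  hom_zero (tush X) (tush Y) <-> hom_zero X Y.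
Proof. exact (@hom_zero_sh (op_tricat K) Y X). Qed.

Section TrianglesDual.
Variables (K : tricat) (X Y Z W : K) (f : Hom X Y) (g : Hom Y Z).
Hypothesis t : tri f g.

Lemma hom_zero_tri_mid_op : hom_zero X W -> hom_zero Z W -> hom_zero Y W.
Proof. by move=> XW ZW; apply: (@hom_zero_tri_mid (op_tricat K) Z Y X W g f). Qed.

Lemma hom_zero_tri_l_op : hom_zero (tush Z) W -> hom_zero Y W -> hom_zero X W.
Proof. by move=> ZW YW; apply: (@hom_zero_tri_r (op_tricat K) Z Y X W g f). Qed.

End TrianglesDual.

(** * t-structures *)

(** Cones and fibres are listed side by side so that the definition is its own
    dual. *)
Record tsub (K : tricat) (A : set K) : Prop := {
  tsub_iso : forall X Y : K, isomorphic X Y -> A X -> A Y;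
  tsub_tsh : forall X : K, A X -> A (tsh X);
  tsub_tush : forall X : K, A X -> A (tush X);
  tsub_tri_l : forall (X Y Z : K) (f : Hom X Y) (g : Hom Y Z),
    tri f g -> A Y -> A Z -> A X;
  tsub_tri_r : forall (X Y Z : K) (f : Hom X Y) (g : Hom Y Z),
    tri f g -> A X -> A Y -> A Z
}.

Lemma tsub_setT (K : tricat) : tsub [set: K].
Proof. by []. Qed.

Lemma tsub_op (K : tricat) (A : set K) : tsub A -> tsub (A : set (op_tricat K)).
Proof.
case=> iso sh ush l r.
split=> // [X Y [f [g [gf fg]]]|X Y Z f g t AY AZ|X Y Z f g t AX AY].
- by apply: iso; exists g, f.
- exact: r t AZ AY.
- exact: l t AY AX.
Qed.

(** Each half of the t-structure is the full orthogonal of the other inside A.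
    Invariance under isomorphisms and closure under extensions thus reduce to the
    vanishing of morphisms, and the notion is self-dual once the truncation
    triangle can be shifted ([tstr_tri_tsh]). *)
Record tstr (K : tricat) (A le ge : set K) : Prop := {
  tstr_leP : forall X, le X <-> A X /\ forall Y, ge Y -> hom_zero X (tush Y);
  tstr_geP : forall Y, ge Y <-> A Y /\ forall X, le X -> hom_zero (tsh X) Y;
  tstr_le_tsh : forall X, le X -> le (tsh X);
  tstr_tri : forall X, A X -> exists (L R : K) (f : Hom L X) (g : Hom X (tush R)),
    [/\ le L, ge R & tri f g]
}.

Section TStructure.
Variables (K : tricat) (A le ge : set K).
Hypotheses (subA : tsub A) (tA : tstr A le ge).

Lemma tstr_ge_tush Y : ge Y -> ge (tush Y).
Proof.
case/(tstr_geP tA) => AY leY; apply/(tstr_geP tA).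
split=> [|X leX]; first exact: (tsub_tush).
exact/(hom_zero_adj (tsh X) Y)/leY/(tstr_le_tsh tA).
Qed.

(** Rotating the truncation triangle of X[-1] three times. *)
Lemma tstr_tri_tsh X : A X -> exists (L R : K) (f : Hom (tsh L) X) (g : Hom X R),
  [/\ le L, ge R & tri f g].
Proof.
move=> AX; have [L [R [f [g [leL geR tfg]]]]] := tstr_tri tA (tsub_tush subA AX).
have [f' [g' t']] := tri_sh tfg.
have [e [e' [e'e ee']]] := tsh_tush X; have [i iI] := tsh_tush R.
exists L, R, (e ∘ f'), (i ∘ (g' ∘ e')); split=> //.
exact/(tri_isor iI)/(tri_isom e'e ee').
Qed.

Lemma tstr_op : @tstr (op_tricat K) A ge le.
Proof.
split=> [X|X|X|X AX]; [exact: (tstr_geP tA)|exact: (tstr_leP tA)|exact: tstr_ge_tush|].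
by have [L [R [f [g [leL geR t]]]]] := tstr_tri_tsh AX; exists R, L, g, f.
Qed.

Lemma tstr_hom_zero_sh X Y : le X -> ge Y -> hom_zero (tsh X) Y.
Proof. by move=> leX /(tstr_geP tA) [_]; apply. Qed.

Lemma tstr_hom_zero X Y : le X -> ge Y -> hom_zero X (tush Y).
Proof. by move=> /(tstr_leP tA) [_]; apply. Qed.

End TStructure.

Section Truncation.
Variables (K : tricat) (le ge : set K).
Hypothesis tK : tstr setT le ge.

Lemma tstr_le_of X : (forall Y, ge Y -> hom_zero X (tush Y)) -> le X.
Proof. by move=> XY; apply/(tstr_leP tK). Qed.

Lemma tstr_le_mid X Y Z (f : Hom X Y) (g : Hom Y Z) :
  tri f g -> le X -> le Z -> le Y.
Proof.
move=> t leX leZ; apply: tstr_le_of => W geW.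
by apply: (hom_zero_tri_mid_op t); apply: (tstr_hom_zero tK).
Qed.

Lemma tstr_le_r X Y Z (f : Hom X Y) (g : Hom Y Z) :
  tri f g -> le X -> le Y -> le Z.
Proof.
move=> /tri_rot [h t] leX leY; apply: (tstr_le_mid t) => //.
exact: (tstr_le_tsh tK leX).
Qed.

End Truncation.

Section TruncationDual.
Variables (K : tricat) (le ge : set K).
Hypothesis tK : tstr setT le ge.

Lemma tstr_ge_of Y : (forall X, le X -> hom_zero (tsh X) Y) -> ge Y.
Proof. exact: (tstr_le_of (tstr_op (@tsub_setT K) tK)). Qed.

Lemma tstr_ge_mid X Y Z (f : Hom X Y) (g : Hom Y Z) :
  tri f g -> ge X -> ge Z -> ge Y.
Proof.
by move=> t geX geZ;
  apply: (tstr_le_mid (tstr_op (@tsub_setT K) tK) (X := Z) (Z := X) t).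
Qed.

Lemma tstr_ge_l X Y Z (f : Hom X Y) (g : Hom Y Z) :
  tri f g -> ge Y -> ge Z -> ge X.
Proof.
by move=> t geY geZ;
  apply: (tstr_le_r (tstr_op (@tsub_setT K) tK) (X := Z) (Y := Y) t).
Qed.

End TruncationDual.

(** * The connectively induced t-structure *)

(** Phrased with short exact sequences instead of monomorphisms, the condition in
    the opposite category concerns the same short exact sequences, with the
    quotients ascending.  One repetition in every chain is what the existence of
    maximal subobjects requires. *)
Definition ses_noetherian (K : tricat) (H : set K) : Prop :=
  forall (X : K) (S Q : nat -> K) (s : forall n, Hom (S n) X)
    (q : forall n, Hom X (Q n)),
  H X -> (forall n, [/\ H (S n), H (Q n) & tri (s n) (q n)]) ->
  (forall n, exists u, s n = s n.+1 ∘ u) ->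
  exists n, exists u, s n.+1 = s n ∘ u.

Record ses (K : tricat) (H : set K) (X : K) := Ses {
  ses_sub : K;
  ses_quo : K;
  ses_in : Hom ses_sub X;
  ses_out : Hom X ses_quo;
  sesP : [/\ H ses_sub, H ses_quo & tri ses_in ses_out]
}.

(** Dependent choice: without a maximal element, strict enlargements could be
    iterated from s0 forever. *)
Lemma ses_noetherian_max (K : tricat) (H T : set K) (X : K) (s0 : ses H X) :
  ses_noetherian H -> H X -> T (ses_sub s0) ->
  exists2 s : ses H X, T (ses_sub s) & forall s' : ses H X, T (ses_sub s') ->
    (exists u, ses_in s = ses_in s' ∘ u) -> exists u, ses_in s' = ses_in s ∘ u.
Proof.
move=> noeH HX Ts0; apply: contrapT => nomax.
pose St := {s : ses H X | T (ses_sub s)}.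
pose lt (s s' : St) := (exists u, ses_in (sval s) = ses_in (sval s') ∘ u) /\
  ~ (exists u, ses_in (sval s') = ses_in (sval s) ∘ u).
have /choice [next nextP] : forall s, exists s', lt s s'.
  move=> [s Ts]; apply: contrapT => nos; apply: nomax; exists s => // s' Ts' ss'.
  by apply: contrapT => ns's; apply: nos; exists (exist _ s' Ts').
pose st n := sval (iter n next (exist _ s0 Ts0)).
have [n [u su]] := noeH X _ _ (fun n => ses_in (st n)) (fun n => ses_out (st n))
  HX (fun n => sesP (st n)) (fun n => proj1 (nextP _)).
by case: (nextP (iter n next (exist _ s0 Ts0))) => _; apply; exists u.
Qed.

Section Connective.
Variables (K : tricat) (B C le ge : set K).
Hypotheses (subB : tsub B) (subC : tsub C).
Hypothesis orth : forall X Y, C X -> B Y -> hom_zero X Y.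
Hypothesis decomp : forall X : K, exists (c b : K) (f : Hom c X) (g : Hom X b),
  [/\ C c, B b & tri f g].
Hypothesis tK : tstr setT le ge.
Hypothesis tB : tstr B (le `&` B) (ge `&` B).
Hypothesis noe : ses_noetherian (le `&` ge).

(** The nonpositive half of the t-structure obtained by tilting the heart at the
    torsion class of objects left orthogonal to B ∩ heart. *)
Definition tilted : set K :=
  [set E | le E /\ forall b, le b -> ge b -> B b -> hom_zero E b].

Lemma tilted_tsh E : le E -> tilted (tsh E).
Proof.
move=> leE; split=> [|b _ geb _]; first exact: (tstr_le_tsh tK).
exact: (tstr_hom_zero_sh tK).
Qed.

Lemma tilted_mid X Y Z (f : Hom X Y) (g : Hom Y Z) :
  tri f g -> tilted X -> tilted Z -> tilted Y.
Proof.
move=> t [leX bX] [leZ bZ]; split=> [|b leb geb Bb].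
  exact: (tstr_le_mid tK t).
by apply: (hom_zero_tri_mid_op t); [apply: bX | apply: bZ].
Qed.

Lemma C_tilted X : C X -> le X -> tilted X.
Proof. by move=> CX leX; split=> // b _ _; apply: orth. Qed.

(** The image of f, without cohomology functors: the cokernel of f is the
    truncation Ck of its cone W, and I is the fibre of Q -> Ck.  By the octahedral
    axiom I is an extension of tau^{<= -1} W by E, hence tilted; this is the
    closure of the torsion class under quotients. *)
Lemma image_of_tilted E Q (f : Hom E Q) : tilted E -> le Q -> ge Q ->
  exists (I Ck : K) (e : Hom E I) (m : Hom I Q) (k : Hom Q Ck),
  [/\ tilted I, (le `&` ge) I, (le `&` ge) Ck, f = m ∘ e & tri m k].
Proof.
move=> tltE leQ geQ; have [W [w tw]] := tri_cone f.
have [L [Ck [l [r [leL geCk tlr]]]]] := tstr_tri_tsh (@tsub_setT K) tK (X := W) I.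
have [J [m tm]] := tri_fib (r ∘ w).
have [e [v [tev me _]]] := tri_octa_fib tw tlr tm.
have tltJ : tilted J by apply: (tilted_mid tev) => //; apply: tilted_tsh.
have leW := tstr_le_r tK tw tltE.1 leQ.
have leCk : le Ck by apply: (tstr_le_r tK tlr) => //; apply: (tstr_le_tsh tK).
exists J, Ck, e, m, (r ∘ w); split=> //; split=> //.
  by case: tltJ.
exact: (tstr_ge_l tK tm geQ geCk).
Qed.

(** S is a maximal tilted subobject of H.  A morphism from a tilted E to H/S has a
    tilted image I, and the preimage S' of I in H is a tilted subobject
    containing S; maximality forces I = 0. *)
Lemma heart_torsion_pair H : le H -> ge H ->
  exists (S Q : K) (s : Hom S H) (q : Hom H Q),
  [/\ tilted S, tri s q & forall E, tilted E -> hom_zero E Q].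
Proof.
move=> leH geH.
have [Z [z [Z0 tz]]] := tri_idr H.
have heZ : (le `&` ge) Z.
  split; first by apply: (tstr_le_of tK) => Y _; apply: (Z0 _).2.
  by apply: (tstr_ge_of tK) => Y _; apply: (Z0 _).1.
have tltZ : tilted Z by split=> [|b _ _ _]; [exact: heZ.1 | exact: (Z0 _).2].
pose s0 := @Ses K (le `&` ge) H Z H z (idm H) (And3 heZ (conj leH geH) tz).
have [[S Q s q [heS heQ tsq]] /= tltS maxS] :=
  @ses_noetherian_max _ _ tilted _ s0 noe (conj leH geH) tltZ.
exists S, Q, s, q; split=> // E tltE f.
have [I [Ck [e [m [k [tltI heI heCk -> tmk]]]]]] := image_of_tilted f tltE heQ.1 heQ.2.
have [S' [s' ts']] := tri_fib (k ∘ q).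
have [u [v [tuv s'u mv]]] := tri_octa_fib tsq tmk ts'.
have heS' : (le `&` ge) S'.
  split; first exact: (tstr_le_mid tK tuv heS.1 heI.1).
  exact: (tstr_ge_mid tK tuv heS.2 heI.2).
have [||w /= s'E] := maxS (@Ses _ _ _ S' Ck s' (k ∘ q) (And3 heS' heCk ts')).
- exact: (tilted_mid tuv tltS tltI).
- by exists u.
have mv0 : m ∘ v = 0 by rewrite mv s'E /= compA (tri_comp0 tsq) comp0m.
have [h tvh] := tri_rot tuv.
have [x ->] := (tri_coexactP m tvh).1 mv0.
by rewrite (tstr_hom_zero_sh tK heS.1 heQ.2 x) !comp0m.
Qed.

(** P' is the fibre of P -> H^0(P) -> Q, with Q the torsion-free part of H^0(P);
    it is an extension of the torsion part by tau^{<= -1} P. *)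
Lemma tilted_coreflection P : le P ->
  exists (P' Q : K) (f : Hom P' P) (g : Hom P Q),
  [/\ tilted P', tri f g & forall E, tilted E -> hom_zero E Q].
Proof.
move=> leP.
have [L [H [l [r [leL geH tlr]]]]] := tstr_tri_tsh (@tsub_setT K) tK (X := P) I.
have leH : le H by apply: (tstr_le_r tK tlr) => //; apply: (tstr_le_tsh tK).
have [S [Q [s [q [tltS tsq orthQ]]]]] := heart_torsion_pair leH geH.
have [P' [p tp]] := tri_fib (q ∘ r).
have [u [v [tuv _ _]]] := tri_octa_fib tlr tsq tp.
exists P', Q, p, (q ∘ r); split=> //.
by apply: (tilted_mid tuv) => //; apply: tilted_tsh.
Qed.

(** The truncation b -> R = tau^{>=0} b stays inside B.  A morphism P -> R factors
    through H^0(b), as P is nonpositive, and so vanishes because P is tilted.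
    Since b is universal among the maps from P to B, already b -> R vanishes;
    thus b is in D^{<= -1} and c, the fibre of P -> b, in D^{<=0}. *)
Lemma tilted_C_part_le P c b (f : Hom c P) (g : Hom P b) :
  tilted P -> C c -> B b -> tri f g -> le c.
Proof.
move=> [leP tltP] Cc Bb tfg.
have [L [R [l [r [[leL BL] [geR BR] tlr]]]]] := tstr_tri_tsh subB tB Bb.
have r0 : r = 0.
  (* M = H^0(b): it is the truncation tau^{<=0} R of an object R of D^{>=0} *)
  have [M [R' [m [n [[leM BM] [geR' BR'] tmn]]]]] := tstr_tri tB BR.
  have geM : ge M.
    apply: (tstr_ge_l tK tmn) => //.
    exact: (tstr_ge_tush (@tsub_setT K) tK geR').
  have PR : hom_zero P R.
    by apply: (hom_zero_tri_mid tmn); [exact: tltP | exact: (tstr_hom_zero tK leP geR')].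
  have [h th] := tri_rot tfg.
  have [x ->] := (tri_coexactP r th).1 (PR _).
  by rewrite (orth (tsub_tsh subC Cc) BR x) comp0m.
apply: (tstr_le_of tK) => Y geY.
apply: (hom_zero_tri_l_op tfg); last exact: (tstr_hom_zero tK leP geY).
(* b -> R vanishes, so sh L -> b is a split epimorphism and b inherits
   nonpositivity of degree -1 from sh L *)
apply/hom_zero_ush => x.
have [y ->] := (tri_coexactP x tlr).1 (tstr_hom_zero_sh tK leL geY _).
by rewrite r0 compm0.
Qed.

Theorem conn_tstr : tstr C (le `&` C)
  [set Y | C Y /\ forall X, (le `&` C) X -> hom_zero (tsh X) Y].
Proof.
have approx X : C X -> exists (L R : K) (f : Hom L X) (g : Hom X R),
    [/\ (le `&` C) L, C R, tri f g & forall E, (le `&` C) E -> hom_zero E R].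
  move=> CX.
  have [P [R0 [f0 [g0 [leP geR0 t0]]]]] := tstr_tri tK (X := X) I.
  have [P' [R1 [f1 [g1 [tltP' t1 orthR1]]]]] := tilted_coreflection leP.
  have [c [b [f2 [g2 [Cc Bb t2]]]]] := decomp P'.
  have lec := tilted_C_part_le tltP' Cc Bb t2.
  have [| |R [g [tR leCR]]] := approx_trans (T := le `&` C) t0 t1.
  - by move=> E [leE _]; apply: (tstr_hom_zero tK leE geR0).
  - by move=> E [leE CE]; apply/orthR1/C_tilted.
  have [//||R' [g' [tR' leCR']]] := approx_trans (T := le `&` C) tR t2.
  - by move=> E [_ CE]; apply: orth.
  exists c, R', (f0 ∘ f1 ∘ f2), g'; split=> //.
  exact: (tsub_tri_r subC tR' Cc CX).
split=> [X|//|X [leX CX]|X CX].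
- split=> [[leX CX]|[CX geX]]; first by split=> // Y [_ /(_ X) h]; apply/hom_zero_adj/h.
  split=> //; apply: (tstr_le_of tK) => Y geY.
  have [L [R [f [g [[leL CL] CR tfg leCR]]]]] := approx X CX.
  have XR : hom_zero X R.
    apply: (hom_zero_isor (tush_tsh R)); apply: geX; split.
      exact: tsub_tsh.
    by move=> E leCE; apply/hom_zero_sh/leCR.
  move=> x; have [y ->] := (tri_coexactP x tfg).1 (tstr_hom_zero tK leL geY _).
  by rewrite (XR g) compm0.
- by split; [exact: (tstr_le_tsh tK leX) | exact: tsub_tsh].
have [L [R [f [g [leCL CR tfg leCR]]]]] := approx X CX.
have [e eI] := isomorphic_sym (tush_tsh R).
exists L, (tsh R), f, (e ∘ g); split=> //; last exact: tri_isor.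
by split=> [|E leCE]; [exact: tsub_tsh| apply/hom_zero_sh/leCR].
Qed.

End Connective.

(** * The self-dual fragment of a triangulated category *)

(** Only quasi-inverses of the shift are given, so full faithfulness has to be
    extracted from the two natural isomorphisms. *)
Lemma fhom_inj (C D : preadditive) (F : functor C D) (G : functor D C) 
    (X Y : C) (f g : Hom X Y) :
  left_quasi_inverse F G -> fhom F f = fhom F g -> f = g.
Proof.
move=> [eta [eta_iso eta_nat]] Ffg.
have [e [e1 _]] := eta_iso Y.
by rewrite -(comp1m f) -(comp1m g) -e1 -!compA !eta_nat Ffg.
Qed.

Lemma fhom_surj (C D : preadditive) (F : functor C D) (G : functor D C) 
    (X Y : C) (k : Hom (F X) (F Y)) :
  left_quasi_inverse F G -> left_quasi_inverse G F ->
  exists f : Hom X Y, fhom F f = k.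
Proof.
move=> qFG qGF; have [eta [eta_iso eta_nat]] := qFG.
have [e [_ e2]] := eta_iso Y; have [d [_ d2]] := eta_iso X.
exists (e ∘ fhom G k ∘ eta X).
apply: (fhom_inj qGF).
rewrite -(compm1 (fhom G (fhom F _))) -d2 compA -eta_nat.
by rewrite -!compA d2 compm1 !compA e2 comp1m.
Qed.

Lemma fhom_iso (C D : preadditive) (F : functor C D) (X Y : C) :
  isomorphic X Y -> isomorphic (F X) (F Y).
Proof.
by move=> [f [g [gf fg]]]; exists (fhom F f), (fhom F g); rewrite -!fhomM gf fg !fhom1.
Qed.

Section Triangulated.
Variable D : triangulated.

Lemma sh_inj (X Y : D) (f g : Hom X Y) : fhom sh f = fhom sh g -> f = g.
Proof. exact/fhom_inj/(sh_ush D). Qed.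

Lemma sh_surj (X Y : D) (k : Hom (sh X) (sh Y)) : exists f, fhom sh f = k.
Proof. exact: fhom_surj (sh_ush D) (ush_sh D). Qed.

Lemma fsh0 (X Y : D) : fhom sh (0 : Hom X Y) = 0.
Proof. by apply: (addrI (fhom sh (0 : Hom X Y))); rewrite -sh_additive !addr0. Qed.

Lemma fshN (X Y : D) (f : Hom X Y) : fhom sh (- f) = - fhom sh f.
Proof. by apply: (addrI (fhom sh f)); rewrite -sh_additive !subrr fsh0. Qed.

Lemma iso_ush_sh (X : D) : isomorphic (ush (sh X)) X.
Proof. by apply: isomorphic_sym; have [eta [eI _]] := sh_ush D; exists (eta X). Qed.

Lemma iso_sh_ush (X : D) : isomorphic (sh (ush X)) X.
Proof. by apply: isomorphic_sym; have [eta [eI _]] := ush_sh D; exists (eta X). Qed.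

Definition dtri (X Y Z : D) (f : Hom X Y) (g : Hom Y Z) : Prop :=
  exists h : Hom Z (sh X), dist f g h.

Lemma dist_isol (X X' Y Z : D) (i : Hom X' X) (j : Hom X X') (f : Hom X Y)
    (g : Hom Y Z) (h : Hom Z (sh X)) :
  i ∘ j = idm X -> j ∘ i = idm X' -> dist f g h -> dist (f ∘ i) g (fhom sh j ∘ h).
Proof.
move=> ij ji; apply: (dist_iso (a := j) (b := idm Y) (c := idm Z)).
- by exists i.
- exact: is_iso_id.
- exact: is_iso_id.
- by rewrite comp1m -compA ij compm1.
- by rewrite comp1m compm1.
by rewrite compm1.
Qed.

Lemma dist_isom (X Y Y' Z : D) (i : Hom Y Y') (j : Hom Y' Y) (f : Hom X Y)
    (g : Hom Y Z) (h : Hom Z (sh X)) :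
  j ∘ i = idm Y -> i ∘ j = idm Y' -> dist f g h -> dist (i ∘ f) (g ∘ j) h.
Proof.
move=> ji ij; apply: (dist_iso (a := idm X) (b := i) (c := idm Z)).
- exact: is_iso_id.
- by exists j.
- exact: is_iso_id.
- by rewrite compm1.
- by rewrite comp1m -compA ji compm1.
by rewrite fhom1 comp1m compm1.
Qed.

Lemma dist_isor (X Y Z Z' : D) (i : Hom Z Z') (j : Hom Z' Z) (f : Hom X Y)
    (g : Hom Y Z) (h : Hom Z (sh X)) :
  j ∘ i = idm Z -> i ∘ j = idm Z' -> dist f g h -> dist f (i ∘ g) (h ∘ j).
Proof.
move=> ji ij; apply: (dist_iso (a := idm X) (b := idm Y) (c := i)).
- exact: is_iso_id.
- exact: is_iso_id.
- by exists j.
- by rewrite compm1 comp1m.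
- by rewrite compm1.
by rewrite fhom1 comp1m -compA ji compm1.
Qed.

Lemma dist_comp0 (X Y Z : D) (f : Hom X Y) (g : Hom Y Z) (h : Hom Z (sh X)) :
  dist f g h -> g ∘ f = 0.
Proof.
move=> t; have [Z0 z0] := has_zero D.
have [|c [<- _]] := dist_fill (a := idm X) (b := f) (dist_id X z0) t.
  by [].
by rewrite compm0.
Qed.

Lemma hom_zero_sh_ush (X Y : D) : hom_zero (sh X) Y <-> hom_zero X (ush Y).
Proof.
split=> XY f.
  apply: sh_inj; rewrite fsh0.
  exact: (hom_zero_isor (isomorphic_sym (iso_sh_ush Y)) XY).
apply: (hom_zero_isor (iso_sh_ush Y)) => k.
by have [k' <-] := sh_surj k; rewrite (XY k') fsh0.
Qed.

Lemma is_zero_sh (Z : D) : is_zero Z -> is_zero (sh Z).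
Proof.
move=> z0 W; split; last by apply/hom_zero_sh_ush; exact: (z0 _).2.
apply: (hom_zero_isol (iso_sh_ush W)) => k.
by have [k' <-] := sh_surj k; rewrite ((z0 _).1 k') fsh0.
Qed.

Lemma dist_rot0 (X Z : D) : is_zero Z -> dist (0 : Hom Z X) (idm X) (0 : Hom X (sh Z)).
Proof.
move=> z0; apply/dist_rot; rewrite fsh0 oppr0; exact/dist_id/is_zero_sh.
Qed.

Lemma dtri_exactP (X Y Z W : D) (f : Hom X Y) (g : Hom Y Z) (u : Hom W Y) :
  dtri f g -> g ∘ u = 0 <-> exists v, u = f ∘ v.
Proof.
move=> [h t]; split=> [gu|[v ->]]; last by rewrite compA (dist_comp0 t) comp0m.
have [Z0 z0] := has_zero D.
have t1 := (dist_rot _ _ _).1 (dist_id W z0).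
have [|c [_ cE]] := dist_fill (a := u) (b := (0 : Hom Z0 Z)) t1 ((dist_rot _ _ _).1 t).
  by rewrite gu comp0m.
have [v vE] := sh_surj c; exists v; apply: sh_inj.
move: cE; rewrite fhom1 compmN compm1 compNm => /oppr_inj ->.
by rewrite fhomM vE.
Qed.

Lemma dtri_coexactP (X Y Z W : D) (f : Hom X Y) (g : Hom Y Z) (u : Hom Y W) :
  dtri f g -> u ∘ f = 0 <-> exists v, u = v ∘ g.
Proof.
move=> [h t]; split=> [uf|[v ->]]; last by rewrite -compA (dist_comp0 t) compm0.
have [Z0 z0] := has_zero D.
have [|c [cg _]] := dist_fill (a := (0 : Hom X Z0)) (b := u) t (dist_rot0 W z0).
  by rewrite uf comp0m.
by exists c; rewrite cg comp1m.
Qed.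

(** The sign and the isomorphism Z = Z[-1][1] are both absorbed in the choice of
    the desuspended connecting morphism. *)
Lemma dtri_unrot (X Y Z : D) (f : Hom X Y) (g : Hom Y Z) :
  dtri f g -> exists h : Hom (ush Z) X, dtri h f.
Proof.
move=> [h t]; have [e [e' [e'e ee']]] := isomorphic_sym (iso_sh_ush Z).
have [k kE] := sh_surj (h ∘ e').
exists (- k), (e ∘ g); apply/dist_rot; rewrite fshN opprK kE.
exact: dist_isor.
Qed.

(** The octahedral axiom for the cones, applied to the rotated triangles, gives
    the octahedron of fibres shifted by one; the shift being fully faithful, it
    can be shifted back. *)
Lemma dtri_octa_fib (X Y Z F G E : D) (f : Hom X Y) (g : Hom Y Z)
    (a : Hom F X) (b : Hom G Y) (c : Hom E X) :
  dtri a f -> dtri b g -> dtri c (g ∘ f) ->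
  exists (u : Hom F E) (v : Hom E G), [/\ dtri u v, c ∘ u = a & b ∘ v = f ∘ c].
Proof.
move=> [h1 /dist_rot t1] [h2 /dist_rot t2] [h3 /dist_rot t3].
have [u [v [tuv [_ uE] [_ vE]]]] := dist_octa t1 t2 t3.
have [u' u'E] := sh_surj u; have [v' v'E] := sh_surj v.
have [w wE] := sh_surj (fhom sh h1 ∘ - fhom sh b).
exists u', v'; split.
- exists (- w); apply/dist_rot/dist_rot/dist_rot; rewrite fshN opprK wE u'E v'E.
  (* Three rotations negate all three morphisms, while an isomorphism of
     triangles changes an even number of signs: the third sign is absorbed in
     the choice of the connecting morphism - w. *)
  have := dist_isom (i := - idm (sh E)) (j := - idm (sh E)) _ _ tuv.
  by rewrite !compNm !compmN !comp1m !compm1 opprK; apply.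
- by apply: sh_inj; rewrite fhomM u'E; apply: oppr_inj; rewrite -uE compNm.
apply: sh_inj; rewrite !fhomM v'E; apply: oppr_inj.
by rewrite -compNm vE compmN.
Qed.

Definition tricat_of : tricat.
Proof.
apply: (@Tricat D (@sh D) (@ush D) dtri).
- exact: iso_sh_ush.
- exact: iso_ush_sh.
- exact: hom_zero_sh_ush.
- by move=> X X' Y Z i f g [j [ji ij]] [h t]; exists (fhom sh j ∘ h); apply: dist_isol.
- by move=> X Y Y' Z i j f g ji ij [h t]; exists h; apply: dist_isom.
- by move=> X Y Z Z' i f g [j [ji ij]] [h t]; exists (h ∘ j); apply: dist_isor.
- by move=> X; have [Z z0] := has_zero D; exists Z, 0; split=> //;
  exists 0; apply: dist_id.
- by move=> X; have [Z z0] := has_zero D; exists Z, 0; split=> //;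
  exists 0; apply: dist_rot0.
- by move=> X Y f; have [Z [g [h t]]] := dist_cone f; exists Z, g, h.
- move=> X Y g; have [Z [k [h t]]] := dist_cone g.
  by have [f tf] := dtri_unrot (ex_intro _ h t); exists (ush Z), f.
- by move=> X Y Z f g [h /dist_rot t]; exists h, (- fhom sh f).
- exact: dtri_unrot.
- exact: dtri_exactP.
- exact: dtri_coexactP.
- move=> X Y Z F G E f g a b c [a' ta] [b' tb] [c' tc].
  have [u [v [tuv [ua _] [vc _]]]] := dist_octa ta tb tc.
  by exists u, v; split=> //; exists (fhom sh a ∘ b').
- exact: dtri_octa_fib.
Defined.

End Triangulated.

(** * t-structures on a triangulated category *)

(** The vanishing of g makes f a split epimorphism; the error idm - v ∘ f of the
    section v factors through R[-1], to which L has no nonzero morphism. *)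
Lemma tri_eq0_iso (K : tricat) (L X R : K) (f : Hom L X) (g : Hom X R) :
  tri f g -> g = 0 -> hom_zero (tsh L) R -> isomorphic L X.
Proof.
move=> t g0 /hom_zero_adj LR.
have [|v vE] := (tri_exactP (idm X) t).1; first by rewrite g0 comp0m.
exists f, v; split=> //; apply/eqP; rewrite -subr_eq0; apply/eqP.
have [h th] := tri_unrot t.
have [|w ->] := (tri_exactP (v ∘ f - idm L) th).1.
  by rewrite compDr compmN compm1 compA -vE comp1m subrr.
by rewrite (LR w) compm0.
Qed.

Lemma tri_eq0_iso_op (K : tricat) (L X R : K) (f : Hom L X) (g : Hom X R) :
  tri f g -> f = 0 -> hom_zero (tsh L) R -> isomorphic X R.
Proof.
move=> t f0 LR; suff [a [b [ba ab]]] : @isomorphic (op_tricat K) R X by exists a, b.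
by apply: (@tri_eq0_iso (op_tricat K) R X L g f t f0); apply/hom_zero_adj.
Qed.

Lemma tstr_unop (K : tricat) (A le ge : set K) :
  tsub A -> @tstr (op_tricat K) A ge le -> tstr A le ge.
Proof. by move=> /tsub_op subA /(tstr_op subA) []. Qed.

Section Translation.
Variable D : triangulated.
Local Notation K := (tricat_of D).

Lemma tsub_of (A : set D) : triangulated_sub A -> @tsub K A.
Proof.
move=> tA; split; [exact: tsub_replete tA|exact: tsub_sh tA|exact: tsub_ush tA| |].
- move=> X Y Z f g [h /dist_rot t] AY AZ.
  exact: (tsub_replete tA (iso_ush_sh X)) (tsub_ush tA (tsub_cone tA t AY AZ)).
- by move=> X Y Z f g [h t]; apply: tsub_cone tA _ _ _ _ _ _ t.
Qed.

Lemma tge1_ush (t : tpair D) Y : t.2 Y -> tge 1 t (ush Y).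
Proof. by exists Y => //; apply: isomorphic_refl. Qed.

(** An object orthogonal to one half has a trivial truncation triangle, hence is
    isomorphic to its own truncation: so the orthogonality of the axioms is
    already full orthogonality. *)
Lemma tstr_of (A : set D) (t : tpair D) :
  @tsub K A -> is_tstructure A t -> @tstr K A t.1 t.2.
Proof.
move=> subA tA.
have leS X : t.1 X -> t.1 (sh X).
  move=> /(tstr_le_shift tA) [Y leY iY]; apply: (tstr_le_replete tA) leY.
  exact/(isomorphic_trans _ (fhom_iso sh iY))/isomorphic_sym/iso_sh_ush.
have approx X : A X -> exists (L R : K) (f : Hom L X) (g : Hom X R),
    [/\ t.1 L, tge 1 t R & tri f g].
  move=> AX; have [L [R [f [g [h [leL geR d]]]]]] := tstr_triangle tA AX.
  by exists L, R, f, g; split=> //; exists h.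
split=> [X|Y|//|X AX].
- split=> [leX|[AX geX]].
    by split=> [|Y geY]; [exact: tstr_le_sub leX | exact/(tstr_orth tA leX)/tge1_ush].
  have [L [R [f [g [leL geR tfg]]]]] := approx X AX.
  apply: (tstr_le_replete tA) (leL); apply: (tri_eq0_iso tfg).
    by case: geR => R' geR' iR; apply: (hom_zero_isor iR (geX _ geR')).
  exact: (tstr_orth tA (leS _ leL) geR).
- split=> [geY|[AY leY]].
    split=> [|X leX]; first exact: tstr_ge_sub geY.
    exact/hom_zero_sh_ush/(tstr_orth tA leX)/tge1_ush.
  have [L [R [f [g [leL geR tfg]]]]] := approx _ (tsub_tush subA AY).
  have iYR : isomorphic (ush Y) R.
    have LY : hom_zero L (ush Y) by apply/(hom_zero_sh_ush L Y)/leY.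
    apply: (tri_eq0_iso_op tfg (LY f)).
    exact: (tstr_orth tA (leS _ leL) geR).
  case: geR => R' geR' iR; apply: (tstr_ge_replete tA) geR'.
  apply: isomorphic_trans (isomorphic_sym (iso_sh_ush R')) _.
  apply: isomorphic_trans (iso_sh_ush Y).
  exact/fhom_iso/(isomorphic_trans iR)/isomorphic_sym.
have [L [R [f [g [leL [R' geR' /isomorphic_sym [i iI]] tfg]]]]] := approx X AX.
by exists L, R', f, (i ∘ g); split=> //; apply: (@tri_isor K) tfg.
Qed.

Lemma is_tstructure_of (A : set D) (t : tpair D) :
  @tsub K A -> @tstr K A t.1 t.2 -> is_tstructure A t.
Proof.
move=> subA tA.
have repl2 : replete t.2.
  move=> X Y iXY /(tstr_geP tA) [AX leX]; apply/(tstr_geP tA).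
  split=> [|Z leZ]; first exact: (tsub_iso subA iXY AX).
  exact: (hom_zero_isor iXY (leX _ leZ)).
split=> //.
- by move=> X /(tstr_leP tA) [].
- by move=> X /(tstr_geP tA) [].
- move=> X Y iXY /(tstr_leP tA) [AX geX]; apply/(tstr_leP tA).
  split=> [|Z geZ]; first exact: (tsub_iso subA iXY AX).
  exact: (hom_zero_isol iXY (geX _ geZ)).
- by move=> X leX; exists (sh X); [exact: (tstr_le_tsh tA leX) | exact: iso_ush_sh].
- by move=> X [Y geY iYX]; apply: repl2 iYX _; apply: (tstr_ge_tush subA tA geY).
- move=> X Y leX [Z geZ iZY].
  exact: (hom_zero_isor iZY (tstr_hom_zero tA leX geZ)).
move=> X AX; have [L [R [f [g [leL geR [h d]]]]]] := tstr_tri tA AX.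
by exists L, (ush R), f, g, h; split=> //; apply: tge1_ush.
Qed.

Lemma mono_in_heart (t : tpair D) (S X Q : D) (s : Hom S X) (q : Hom X Q) :
  @tstr K setT t.1 t.2 -> heart t Q -> dtri s q -> mono_in (heart t) s.
Proof.
move=> tK [_ geQ] tsq T u v [leT _] suv.
apply/eqP; rewrite -subr_eq0; apply/eqP.
have [h th] := dtri_unrot tsq.
have [|w ->] := (dtri_exactP (u - v) th).1.
  by rewrite compDr compmN suv subrr.
by rewrite (tstr_hom_zero tK leT geQ w) compm0.
Qed.

Lemma ses_noetherian_of (t : tpair D) :
  @tstr K setT t.1 t.2 -> noetherian t -> @ses_noetherian K (t.1 `&` t.2).
Proof.
move=> tK noe X S Q s q hX hSQ chain.
have [|N NP] := noe X S s hX _ chain.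
  by move=> n; have [hS hQ sq] := hSQ n; split=> //; apply: mono_in_heart sq.
by exists N; have [] := NP N.+1 (leqnSn N).
Qed.

(** Ascending subobjects of X in the opposite category are quotients S n of X in D
    of which each factors through the next; their kernels Q n then descend, and
    two quotients are comparable as soon as their kernels are. *)
Lemma ses_noetherian_op_of (t : tpair D) :
  @tstr K setT t.1 t.2 -> artinian t ->
  @ses_noetherian (op_tricat K) (t.2 `&` t.1).
Proof.
move=> tK art X S Q s q [geX leX] hSQ chain.
have [|n|N NP] := art X Q q (conj leX geX).
- move=> n; have [[geS leS] [geQ leQ] sq] := hSQ n; split=> //.
  exact: (mono_in_heart tK (conj leS geS) sq).
- have [_ _ sq] := hSQ n; have [_ _ sq'] := hSQ n.+1; have [u su] := chain n.
  apply/(dtri_exactP _ sq).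
  by move: su => /= ->; rewrite -compA (@tri_comp0 K _ _ _ _ _ sq') compm0.
have [_ _ sq] := hSQ N; have [_ _ sq'] := hSQ N.+1.
have [_ [u qu]] := NP N.+1 (leqnSn N).
exists N; apply/(dtri_coexactP _ sq).
by rewrite qu compA (@tri_comp0 K _ _ _ _ _ sq') comp0m.
Qed.

(** A triangulated subcategory contains Y whenever it contains some shift of Y. *)
Lemma shift_set_cap (A S : set D) n X : triangulated_sub A ->
  shift_set n S X -> A X -> shift_set n (S `&` A) X.
Proof.
move=> tA [Y SY iYX] AX; exists Y => //; split=> //.
have {iYX AX}: A (shift n Y) by apply: (tsub_replete tA) AX; apply: isomorphic_sym.
have shA Z : A (sh Z) -> A Z.
  by move=> /(tsub_ush tA); apply/(tsub_replete tA)/iso_ush_sh.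
have ushA Z : A (ush Z) -> A Z.
  by move=> /(tsub_sh tA); apply/(tsub_replete tA)/iso_sh_ush.
by case: n => k /=; [elim: k => //= k IH /shA | move=> /ushA; elim: k => //= k IH /ushA].
Qed.

Lemma bounded_sub (A : set D) (t t' : tpair D) : triangulated_sub A ->
  t.1 `&` A `<=` t'.1 -> t.2 `&` A `<=` t'.2 ->
  bounded setT t -> bounded A t'.
Proof.
move=> tA le' ge' bt X AX; have [a [b [geX leX]]] := bt X I.
exists a, b; split.
  by have [Y /ge' geY iY] := shift_set_cap tA geX AX; exists Y.
by have [Y /le' leY iY] := shift_set_cap tA leX AX; exists Y.
Qed.

End Translation.

Theorem theorem1p3 (D : triangulated) (B C : set D) (t : tpair D)
    (sod : semiorthogonal_decomposition B C)
    (tstr : is_tstructure setT t) :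
  (noetherian t -> restricts t B ->
     connectively_induces t C /\
     (bounded setT t -> bounded C (conn t C)))
  /\
  (artinian t -> restricts t C ->
     coconnectively_induces t B /\
     (bounded setT t -> bounded B (coconn t B))).
Proof.
have [triB triC orth decomp] := sod.
have subB := tsub_of triB; have subC := tsub_of triC.
have tK := tstr_of (@tsub_setT (tricat_of D)) tstr.
have orth0 X Y : C X -> B Y -> hom_zero X Y by move=> CX BY; exact: (orth X Y 0).
split=> [noe /(tstr_of subB) tB | art /(tstr_of subC) tC].
  split.
    apply: (is_tstructure_of subC).
    apply: (conn_tstr subB subC orth0 _ tK tB (ses_noetherian_of tK noe)) => X.
    have [c [b [f [g [h [Cc Bb d]]]]]] := decomp X.
    by exists c, b, f, g; split=> //; exists h.
  apply: bounded_sub => // Y [geY CY]; split=> // X [leX _].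
  exact: (tstr_hom_zero_sh tK leX geY).
have tKop := tstr_op (@tsub_setT (tricat_of D)) tK.
split.
  apply: (is_tstructure_of subB); apply: (tstr_unop subB).
  apply: (@conn_tstr (op_tricat (tricat_of D)) C B t.2 t.1) => //.
  - exact: tsub_op.
  - exact: tsub_op.
  - by move=> X Y BX CY; apply: orth0.
  - move=> X; have [c [b [f [g [h [Cc Bb d]]]]]] := decomp X.
    by exists b, c, g, f; split=> //; exists h.
  - exact: tstr_op subC tC.
  - exact: (ses_noetherian_op_of tK art).
apply: bounded_sub => // X [leX BX]; split=> // Y [geY _].
exact: (tstr_hom_zero tK leX geY).
Qed.
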